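(* Let $V$ be a ground set of $n$ elements and $f$ a nonnegative monotone two-partition submodular function on $V$, accessed by a value oracle; let $p\in(0,1)$. Consider the procedure: query $f(\emptyset)$, $f(V)$ and $f(\{j\})$ for each $j\in V$; for each $i\in\{2,\dots,n-1\}$, independently generate $n^{10}\ln\frac{4n}{1-p}$ random sets by including each element of $V$ in each set independently with probability $i/n$, and query $f$ on each. If among all queried sets there are two sets $S_1,S_2$ with $|S_1|=|S_2|$ and $f(S_1)\ne f(S_2)$, determine $f$ exactly (using polynomially many further queries) and output $\hat f=f$. Otherwise fix an arbitrary $j\in V$ and output $\hat f(S)=f(\emptyset)$ if $S=\emptyset$, $\hat f(S)=f(\{j\})$ if $1\le|S|\le2\sqrt n$, and $\hat f(S)=\frac{f(V)}{2\sqrt n}$ if $|S|>2\sqrt n$. Then with probability at least $p$, the output satisfies $\hat f(S)\le f(S)\le 2\sqrt n\cdot\hat f(S)$ for all $S\subseteq V$.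
   Context: $f:2^V\to\mathbb{R}_{\ge0}$ is submodular if $f(S)+f(T)\ge f(S\cup T)+f(S\cap T)$, monotone if $f(S)\le f(T)$ for $S\subseteq T$. A submodular function $f$ is a two-partition (2P) function if there is a set $R\subseteq V$ such that for all $S$, $f(S)$ depends only on $|S\cap R|$ and $|S\cap(V\setminus R)|$. (A 2P function can be determined exactly with polynomially many queries once two sets of equal size with different values are known.) *)

(* Defs.v *)
From mathcomp Require Import all_boot all_order all_algebra.
From mathcomp Require Import reals exp.
From mathcomp Require Import zify.

Set Implicit Arguments.
Unset Strict Implicit.
Unset Printing Implicit Defensive.

Import Order.TTheory GRing.Theory Num.Theory.
Local Open Scope ring_scope.

Section SetFunctions.
Variables (R : realType) (V : finType).
Implicit Types (f : {set V} -> R) (S T : {set V}).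

Definition nonnegative f := forall S, 0 <= f S.

Definition monotone f := forall S T, S \subset T -> f S <= f T.

Definition submodular f := forall S T, f (S :|: T) + f (S :&: T) <= f S + f T.

Definition two_partition f :=
  submodular f /\
  exists P : {set V}, forall S T,
    #|S :&: P| = #|T :&: P| -> #|S :&: ~: P| = #|T :&: ~: P| -> f S = f T.

End SetFunctions.

(* An adaptive algorithm with value-oracle access to a set function on V: it
   can only learn the function through the answers to its [Query] nodes. *)
Inductive oracle_prog (R : Type) (V : finType) (A : Type) : Type :=
| Ret of A
| Query of {set V} & (R -> oracle_prog R V A).

Arguments Ret {R V A}.
Arguments Query {R V A}.

Fixpoint run (R : Type) (V : finType) (A : Type) (f : {set V} -> R)
    (c : oracle_prog R V A) : A :=
  match c with
  | Ret a => a
  | Query Q k => run f (k (f Q))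
  end.

Fixpoint num_queries (R : Type) (V : finType) (A : Type) (f : {set V} -> R)
    (c : oracle_prog R V A) : nat :=
  match c with
  | Ret _ => 0
  | Query Q k => (num_queries f (k (f Q))).+1
  end.

(* The subroutine "determine f exactly", started from two sets S1, S2 of equal
   size on which f differs. It is a single family over all ground sets, so that
   a polynomial bound on the number of queries is meaningful. *)
Definition determiner (R : realType) : Type :=
  forall V : finType, {set V} -> {set V} -> oracle_prog R V ({set V} -> R).

Definition exact_poly_determiner (R : realType) (D : determiner R) : Prop :=
  exists c d : nat,
    forall (V : finType) (f : {set V} -> R) (S1 S2 : {set V}),
      nonnegative f -> monotone f -> two_partition f ->
      #|S1| = #|S2| -> f S1 <> f S2 ->
      run f (D V S1 S2) =1 f /\
      (num_queries f (D V S1 S2) <= c * #|V| ^ d)%N.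

(* n^10 ln(4n/(1-p)), rounded up; positive when 0 < n and 0 < p < 1. *)
Definition num_samples (R : realType) (n : nat) (p : R) : nat :=
  `|Num.ceil (n%:R ^+ 10 * ln (4 * n%:R / (1 - p)))|%N.

(* A sample (i, k) is the k-th random set with inclusion probability
   (i + 2) / #|V|: the offset makes i + 2 range over 2, ..., #|V| - 1. *)
Definition samples (V : finType) (m : nat) : finType :=
  {ffun 'I_(#|V| - 2) * 'I_m -> {set V}}.

Definition incl_pmf (R : realType) (V : finType) (q : R) (S : {set V}) : R :=
  \prod_(v : V) (if v \in S then q else 1 - q).

Definition samples_pmf (R : realType) (V : finType) (m : nat)
    (X : samples V m) : R :=
  \prod_(ik : 'I_(#|V| - 2) * 'I_m)
    incl_pmf (ik.1.+2%:R / #|V|%:R) (X ik).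

Definition samples_prob (R : realType) (V : finType) (m : nat)
    (E : pred (samples V m)) : R :=
  \sum_(X : samples V m | E X) samples_pmf R X.

Section Procedure.
Variables (R : realType) (D : determiner R) (V : finType).
Variables (f : {set V} -> R) (j : V) (m : nat) (X : samples V m).

Definition queried : {set {set V}} :=
  [set S | [|| S == set0, S == setT, [exists v, S == [set v]]
             | [exists ik, S == X ik]]].

Definition default_output (S : {set V}) : R :=
  if S == set0 then f set0
  else if #|S|%:R <= 2 * Num.sqrt (#|V|%:R : R) then f [set j]
  else f setT / (2 * Num.sqrt #|V|%:R).

Definition procedure_output : {set V} -> R :=
  if [pick ST : {set V} * {set V} |
        [&& ST.1 \in queried, ST.2 \in queried, #|ST.1| == #|ST.2|
          & f ST.1 != f ST.2]] is Some ST
  then run f (D ST.1 ST.2)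
  else default_output.

Definition approximates (g : {set V} -> R) : bool :=
  [forall S : {set V},
     (g S <= f S) && (f S <= 2 * Num.sqrt #|V|%:R * g S)].

End Procedure.

(* The class [exact_poly_determiner] is inhabited: walk from S1 to S2 by swaps
   until two sets A + x, A + y have different values; these separate x from y,
   and one query per element then sorts V into the two parts, after which
   tabulating f on one set per pair of intersection sizes determines f. *)
Section DeterminerExists.
Variables (R : realType) (V : finType).
Implicit Types (f : {set V} -> R) (S A P : {set V}) (x y z : V).

Fixpoint query_map (T : eqType) (s : seq T) (q : T -> {set V}) (h : T -> R)
    (k : (T -> R) -> oracle_prog R V ({set V} -> R)) :=
  if s is t :: s' then
    Query (q t) (fun v => query_map s' q (fun u => if u == t then v else h u) k)
  else k h.

Lemma query_mapP (T : eqType) (s : seq T) q h k f :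
  exists2 h', {in s, forall t, h' t = f (q t)} &
    run f (query_map s q h k) = run f (k h') /\
    num_queries f (query_map s q h k) = (size s + num_queries f (k h'))%N.
Proof.
suff [h' [h's _ e]] : exists h', [/\ {in s, forall t, h' t = f (q t)},
    {in predC (mem s), h' =1 h} &
    run f (query_map s q h k) = run f (k h') /\
    num_queries f (query_map s q h k) = (size s + num_queries f (k h'))%N].
  by exists h'.
elim: s h => [|t s IH] h /=; first by exists h.
have [h' [h1 h2 [h3 h4]]] := IH (fun u => if u == t then f (q t) else h u).
exists h'; split; last by rewrite h3 h4.
- move=> u; rewrite inE; case: (boolP (u \in s)) => [us _|us]; first exact: h1.
  by rewrite orbF => /eqP e; rewrite h2 ?inE // e eqxx.
- move=> u; rewrite !inE negb_or => /andP[ut us].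
  by rewrite h2 ?inE // (negbTE ut).
Qed.

Definition probe A x y z := if z \in A then x |: (y |: A :\ z) else z |: A.

Definition representative P (ab : 'I_#|V|.+1 * 'I_#|V|.+1) : {set V} :=
  [set z in take ab.1 (enum P)] :|: [set z in take ab.2 (enum (~: P))].

Definition sort_and_tabulate A x y : oracle_prog R V ({set V} -> R) :=
  query_map (enum V) (probe A x y) (fun=> 0) (fun h =>
    let P := [set z | h z == h (if z \in A then y else x)] in
    query_map (enum {: 'I_#|V|.+1 * 'I_#|V|.+1}) (representative P) (fun=> 0)
      (fun g => Ret (fun S => g (inord #|S :&: P|, inord #|S :&: ~: P|)))).

Fixpoint walk (n : nat) S1 S2 : oracle_prog R V ({set V} -> R) :=
  if n isn't n'.+1 then Ret (fun=> 0) else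
  match [pick x in S1 :\: S2], [pick y in S2 :\: S1] with
  | Some x, Some y =>
      Query S1 (fun v1 => Query (y |: S1 :\ x) (fun v2 =>
        if v1 == v2 then walk n' (y |: S1 :\ x) S2
        else sort_and_tabulate (S1 :\ x) x y))
  | _, _ => Ret (fun=> 0)
  end.

Definition depends_on f P := forall S T,
  #|S :&: P| = #|T :&: P| -> #|S :&: ~: P| = #|T :&: ~: P| -> f S = f T.

Lemma depends_onC f P : depends_on f P -> depends_on f (~: P).
Proof. by move=> fP S T e1 e2; apply: fP; rewrite // -[P]setCK. Qed.

Lemma cardU1I A P z :
  z \notin A -> #|(z |: A) :&: P| = ((z \in P) + #|A :&: P|)%N.
Proof.
move=> zA; case: (boolP (z \in P)) => zP.
  have -> : (z |: A) :&: P = z |: (A :&: P).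
    by apply/setP=> u; rewrite !inE; case: eqP => // ->; rewrite zP.
  by rewrite cardsU1 inE (negbTE zA).
rewrite add0n; suff -> : (z |: A) :&: P = A :&: P by [].
apply/setP=> u; rewrite !inE.
by case: eqP => // ->; rewrite (negbTE zP) !andbF.
Qed.

Lemma depends_on_swap f P A u v : depends_on f P -> u \notin A -> v \notin A ->
  (u \in P) = (v \in P) -> f (u |: A) = f (v |: A).
Proof. by move=> fP uA vA uv; apply: fP; rewrite !cardU1I // ?inE uv. Qed.

Lemma probe_class f P A x y : depends_on f P -> x \notin A -> y \notin A ->
  f (x |: A) != f (y |: A) -> x \in P ->
  [set z | f (probe A x y z) == f (probe A x y (if z \in A then y else x))] = P.
Proof.
move=> fP xA yA fxy xP.
have yP : y \notin P.
  apply: contra fxy => yP; apply/eqP.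
  by apply: (depends_on_swap fP); rewrite // xP yP.
have xy : x != y by apply: contraNneq yP => <-.
apply/setP=> z; rewrite inE /probe; case: (boolP (z \in A)) => zA.
  rewrite (negbTE yA).
  have zx : z != x by apply: contraNneq xA => <-.
  have zy : z != y by apply: contraNneq yA => <-.
  have xB : x \notin y |: A :\ z by rewrite !inE negb_or xy (negbTE xA) andbF.
  have zB : z \notin y |: A :\ z by rewrite !inE negb_or zy eqxx.
  have zyA : z |: (y |: A :\ z) = y |: A by rewrite setUCA setD1K.
  have yB : y \notin x |: A :\ z.
    by rewrite !inE negb_or eq_sym xy (negbTE yA) andbF.
  have zB' : z \notin x |: A :\ z by rewrite !inE negb_or zx eqxx.
  have zxA : z |: (x |: A :\ z) = x |: A by rewrite setUCA setD1K.
  case: (boolP (z \in P)) => zP.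
    by rewrite (@depends_on_swap f P _ x z) ?zyA ?eqxx // xP zP.
  rewrite setUCA (@depends_on_swap f P _ y z) ?zxA ?(negbTE zP) ?(negbTE yP) //.
  exact: negbTE.
rewrite (negbTE xA); case: (boolP (z \in P)) => zP.
  by apply/eqP/(depends_on_swap fP); rewrite // xP zP.
rewrite (@depends_on_swap f P _ z y) ?(negbTE zP) ?(negbTE yP) //.
by rewrite eq_sym; exact: negbTE.
Qed.

Lemma card_take_enum P n : (n <= #|P|)%N -> #|[set z in take n (enum P)]| = n.
Proof.
move=> nP; rewrite cardsE (card_uniqP _) ?take_uniq ?enum_uniq //.
by rewrite size_take_min -cardE; apply/minn_idPl.
Qed.

Lemma take_enum_sub P n : [set z in take n (enum P)] \subset P.
Proof. by apply/subsetP=> z; rewrite inE => /mem_take; rewrite mem_enum. Qed.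

Lemma representativeP f P S : depends_on f P ->
  f (representative P (inord #|S :&: P|, inord #|S :&: ~: P|)) = f S.
Proof.
move=> fP; have sub Q : (#|S :&: Q| <= #|Q|)%N by rewrite subset_leq_card ?subsetIr.
have lt Q : (#|S :&: Q| < #|V|.+1)%N by rewrite ltnS max_card.
rewrite /representative /= !inordK //.
set B := [set z in take _ (enum P)]; set C := [set z in take _ _].
have BP : B \subset P := take_enum_sub _ _.
have CP : C \subset ~: P := take_enum_sub _ _.
have e1 : (B :|: C) :&: P = B.
  rewrite setIUl (setIidPl BP); apply/setUidPl/subsetP=> z; rewrite inE.
  by case/andP=> /(subsetP CP); rewrite inE => /negbTE->.
have e2 : (B :|: C) :&: ~: P = C.
  rewrite setIUl (setIidPl CP); apply/setUidPr/subsetP=> z; rewrite inE.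
  by case/andP=> /(subsetP BP) zP; rewrite inE zP.
by apply: fP; rewrite ?e1 ?e2 card_take_enum.
Qed.

Lemma sort_and_tabulateP f P A x y :
  depends_on f P -> x \notin A -> y \notin A -> f (x |: A) != f (y |: A) ->
  run f (sort_and_tabulate A x y) =1 f /\
  num_queries f (sort_and_tabulate A x y) = (#|V| + #|V|.+1 * #|V|.+1)%N.
Proof.
wlog xP : P / x \in P => [th|] fP xA yA fxy.
  case: (boolP (x \in P)) => xP; first exact: (th P).
  by apply: (th (~: P)); rewrite ?inE //; apply: depends_onC.
rewrite /sort_and_tabulate.
set k := (X in query_map (enum V) _ _ X).
have [h hE [-> ->]] := query_mapP (enum V) (probe A x y) (fun=> 0) k f.
have {}hE z : h z = f (probe A x y z) by apply: hE; rewrite mem_enum.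
rewrite /k /=.
have -> : [set z | h z == h (if z \in A then y else x)] = P.
  by rewrite -[RHS](probe_class fP xA yA fxy xP); apply/setP=> z; rewrite !inE !hE.
set k' := (X in query_map _ _ _ X).
have [g gE [-> ->]] := query_mapP (enum {: 'I_#|V|.+1 * 'I_#|V|.+1})
   (representative P) (fun=> 0) k' f.
rewrite /k' /=; split.
  by move=> S; rewrite gE ?mem_enum // representativeP.
by rewrite addn0 -!cardE card_prod !card_ord.
Qed.

Lemma walkP n f P S1 S2 : depends_on f P -> #|S1| = #|S2| -> f S1 <> f S2 ->
  (#|S1 :\: S2| <= n)%N ->
  run f (walk n S1 S2) =1 f /\
  (num_queries f (walk n S1 S2) <= 2 * n + #|V| + #|V|.+1 * #|V|.+1)%N.
Proof.
move=> fP; elim: n S1 => [|n IH] S1 S12 fS le.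
  case: fS; congr f; apply/eqP; rewrite eqEcard S12 leqnn andbT -setD_eq0.
  by rewrite -cards_eq0 -leqn0.
have D12 : #|S1 :\: S2| = #|S2 :\: S1| by rewrite !cardsD setIC S12.
have D0 : S1 :\: S2 != set0.
  apply/eqP=> D0; case: fS; congr f; apply/eqP.
  by rewrite eqEcard S12 leqnn andbT -setD_eq0 D0.
rewrite /=; case: pickP => [x|D1]; last first.
  by case/set0Pn: D0 => x; rewrite D1.
case: pickP => [y|D2]; last first.
  move: D0; rewrite -card_gt0 D12 card_gt0 => /set0Pn[y]; by rewrite D2.
rewrite !inE => /andP[yS1 yS2] /andP[xS2 xS1] /=.
have yA : y \notin S1 :\ x by rewrite !inE (negbTE yS1) andbF.
have xA : x \notin S1 :\ x by rewrite !inE eqxx.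
case: eqP => [e|/eqP ne].
  have [] := IH (y |: S1 :\ x).
  - by rewrite cardsU1 yA -S12 (cardsD1 x S1) xS1; lia.
  - by rewrite -e.
  - have sub : (y |: S1 :\ x) :\: S2 \subset (S1 :\: S2) :\ x.
      apply/subsetP=> u; rewrite !inE => /andP[uS2 /orP[/eqP uy|/andP[-> ->]]];
        last by rewrite uS2.
      by rewrite uy yS2 in uS2.
    have := subset_leq_card sub; have := cardsD1 x (S1 :\: S2).
    rewrite !inE xS1 xS2 /=; lia.
  move=> rE qE; split=> //; rewrite mulnSr addn2 !addSn !ltnS.
  exact: qE.
have ne' : f (x |: S1 :\ x) != f (y |: S1 :\ x) by rewrite setD1K.
have [rE ->] := sort_and_tabulateP fP xA yA ne'; split=> //.
by rewrite (mulnSr 2) addn2 !addSn !ltnS -addnA leq_addl.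
Qed.

End DeterminerExists.

Lemma exact_poly_determiner_exists (R : realType) :
  exists D : determiner R, exact_poly_determiner D.
Proof.
exists (fun (V : finType) S1 S2 => walk R #|V| S1 S2), 9%N, 2%N.
move=> V f S1 S2 _ _ [_ [P fP]].
move=> S12 fS; have [rE qE] := walkP (n := #|V|) fP S12 fS (max_card _).
split=> //; apply: leq_trans qE _.
have : (0 < #|V|)%N.
  rewrite lt0n; apply/eqP=> V0; apply: fS; congr f; apply/setP=> z.
  by case: (fintype0 z V0).
rewrite -mulnn; nia.
Qed.

(* Main.v *)
Require Import Defs.
From mathcomp Require Import all_boot all_order all_algebra.
From mathcomp Require Import boolp reals sequences exp zify ring lra.
Import Order.TTheory GRing.Theory Num.Theory.
Local Open Scope ring_scope.

Set Implicit Arguments.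
Unset Strict Implicit.
Unset Printing Implicit Defensive.

(** The value f(S) is a function F(x, y) of the profile x = |S n P|, y = |S \ P|.
    Write r = |P|, t = |V \ P|, n = r + t.  Follow a lattice path from (0, 0) to
    (r, t) whose points stay within one unit of the diagonal.  If at each point
    of the path F grows by the same amount in both directions, then by
    submodularity these increments decrease along the path, and Abel summation
    gives F(0, t) >= (t / n) f(V), hence n f(S) >= |S \ P| f(V) by concavity;
    exchanging P with its complement, 2 n f(S) >= |S| f(V).  So the default
    output is correct as soon as all singletons have the same value.

    Otherwise two sets of a common size i, both with profiles close to the mean
    of a random set of rate i / n, have different values.  The largest value of
    a binomial distribution Bin(r, i / n) is at least 1 / (r + 1), is attained
    within two units of any such profile, and each unit step changes the
    probability by a factor at most n^2.  So each of the two profiles has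
    probability at least n^-10, and n^10 ln(4 n / (1 - p)) samples miss one of
    them with probability at most 2 (1 - p) / (4 n) <= 1 - p. *)

(** * Integer binomial weights *)

Section BinomialWeights.
Local Open Scope nat_scope.

(** For a + b = n this is n^r times the probability of x under Bin(r, a / n), kept in [nat] to avoid
    division. *)
Definition bin_weight (a b r x : nat) : nat := 'C(r, x) * (b ^ (r - x) * a ^ x).

Lemma sum_bin_weight a b r : \sum_(x < r.+1) bin_weight a b r x = (a + b) ^ r.
Proof. by rewrite addnC expnDn. Qed.

Lemma bin_weightS a b r x : x < r ->
  x.+1 * b * bin_weight a b r x.+1 = (r - x) * a * bin_weight a b r x.
Proof.
move=> xr; rewrite /bin_weight.
have := mul_bin_left r x; rewrite (_ : r - x = (r - x.+1).+1); last by lia.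
move=> e; rewrite !expnS.
transitivity (x.+1 * 'C(r, x.+1) * (b * b ^ (r - x.+1) * (a * a ^ x))); first by ring.
by rewrite e; ring.
Qed.

(** Both factors in the ratio of consecutive weights lie between 1 and n^2. *)
Lemma bin_weight_step n a b r x : 0 < a -> 0 < b -> a <= n -> b <= n -> r <= n ->
  x < r -> bin_weight a b r x <= n ^ 2 * bin_weight a b r x.+1
        /\ bin_weight a b r x.+1 <= n ^ 2 * bin_weight a b r x.
Proof.
move=> a0 b0 an bn rn xr; have e := bin_weightS a b xr.
split; rewrite expnS expn1.
  apply: (@leq_trans ((r - x) * a * bin_weight a b r x)).
    by rewrite leq_pmull // muln_gt0 subn_gt0 xr.
  by rewrite -e leq_mul2r leq_mul ?orbT //; lia.
apply: (@leq_trans (x.+1 * b * bin_weight a b r x.+1)).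
  by rewrite leq_pmull // muln_gt0 b0.
by rewrite e leq_mul2r leq_mul ?orbT //; lia.
Qed.

Lemma bin_weight_close n a b r x m : 0 < a -> 0 < b -> a <= n -> b <= n ->
  r <= n -> x <= r -> m <= r -> x <= m.+2 -> m <= x.+2 ->
  bin_weight a b r m <= n ^ 4 * bin_weight a b r x.
Proof.
move=> a0 b0 an bn rn xr mr xm mx.
have n0 : 0 < n by lia.
have st z := @bin_weight_step n a b r z a0 b0 an bn rn.
have n4 : n ^ 4 = n ^ 2 * n ^ 2 by rewrite -expnD.
(* A trivial factor n^2 pads distances below 2, so that every case chains two steps. *)
have w1 z : bin_weight a b r z <= n ^ 2 * bin_weight a b r z.
  by rewrite leq_pmull // expn_gt0 n0.
have tr u v w : u <= n ^ 2 * v -> v <= n ^ 2 * w -> u <= n ^ 4 * w.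
  move=> uv vw; apply: leq_trans uv _.
  by rewrite n4 -mulnA leq_mul2l vw orbT.
have : x = m \/ x = m.+1 \/ x = m.+2 \/ m = x.+1 \/ m = x.+2 by lia.
case=> [e|[e|[e|[e|e]]]]; subst.
- exact: tr (w1 _) (w1 _).
- by apply: tr (w1 _) _; apply: (proj1 (st _ _)).
- by apply: tr (proj1 (st _ _)) (proj1 (st _ _)); lia.
- by apply: tr (w1 _) _; apply: (proj2 (st _ _)).
- by apply: tr (proj2 (st _ _)) (proj2 (st _ _)); lia.
Qed.

(** A largest weight is at least the average of the r + 1 weights, and comparing it with its
    neighbours confines m to an interval of length 1. *)
Lemma bin_weight_mode a b r : 0 < a -> 0 < b -> exists m,
  [/\ m <= r, (a + b) ^ r <= r.+1 * bin_weight a b r m,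
      m * (a + b) <= r.+1 * a & r.+1 * a <= m.+1 * (a + b)].
Proof.
move=> a0 b0.
have [m mr mmax] : exists2 m, m <= r &
    forall z, z <= r -> bin_weight a b r z <= bin_weight a b r m.
  have [m _ mmax] := @arg_maxnP 'I_r.+1 ord0 xpredT (bin_weight a b r) isT.
  exists (m : nat) => [|z zr]; first by rewrite -ltnS.
  exact: (mmax (Ordinal (zr : z < r.+1))).
exists m; have sle : (a + b) ^ r <= r.+1 * bin_weight a b r m.
  rewrite -sum_bin_weight -[X in X * bin_weight _ _ _ m]card_ord -sum_nat_const.
  by apply: leq_sum => z _; apply: mmax; rewrite -ltnS.
have w0 : 0 < bin_weight a b r m.
  have : 0 < (a + b) ^ r by rewrite expn_gt0 addn_gt0 a0.
  by case: (bin_weight _ _ _ _) sle => //; rewrite muln0; lia.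
split=> //.
  case: m {sle} mr mmax w0 => [|z] zr mmax w0; first by lia.
  have e := bin_weightS a b zr; have le := mmax z (ltnW zr).
  have : z.+1 * b * bin_weight a b r z.+1 <= (r - z) * a * bin_weight a b r z.+1.
    by rewrite e leq_mul2l le orbT.
  by rewrite leq_pmul2r //; nia.
case: (ltnP m r) => [lt|ge]; last first.
  have -> : m = r by apply/eqP; rewrite eqn_leq mr.
  by rewrite leq_mul2l leq_addr orbT.
have e := bin_weightS a b lt; have le := mmax _ lt.
have : (r - m) * a * bin_weight a b r m <= m.+1 * b * bin_weight a b r m.
  by rewrite -e leq_mul2l le orbT.
by rewrite leq_pmul2r //; nia.
Qed.

(* The open window (kr/n - 1, kr/n + 2), free of division. *)
Definition near_mean (n k r z : nat) : bool :=
  (k * r < z.+1 * n) && (z * n < k * r + 2 * n).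

(* The mode of Bin(r, (k+1)/n) also lies in the window, so it is at distance at
   most 2 from [x], and a unit step costs a factor at most n^2. *)
Lemma bin_weight_near_mean n k r x : k.+1 < n -> r <= n -> x <= r ->
  near_mean n k r x ->
  n ^ r <= r.+1 * n ^ 4 * bin_weight k.+1 (n - k.+1) r x.
Proof.
move=> kn rn xr /andP[x1 x2].
have b0 : 0 < n - k.+1 by lia.
have [m [mr ]] := bin_weight_mode r (isT : 0 < k.+1) b0.
rewrite subnKC; last by lia.
move=> le m1 m2; apply: leq_trans le _.
rewrite -mulnA leq_mul2l bin_weight_close ?orbT //; try lia.
  by rewrite -ltnS -(@ltn_pmul2r n); nia.
by rewrite -ltnS -(@ltn_pmul2r n); nia.
Qed.

End BinomialWeights.

(** * Concave submodular functions on a grid *)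

Section GridFunctions.
Variables (R : realType) (F : nat -> nat -> R) (r t : nat).
Let n := (r + t)%N.
Hypothesis concave_l : forall x y, (x.+1 < r)%N -> (y <= t)%N ->
  F x.+2 y + F x y <= F x.+1 y + F x.+1 y.
Hypothesis concave_r : forall x y, (x <= r)%N -> (y.+1 < t)%N ->
  F x y.+2 + F x y <= F x y.+1 + F x y.+1.
Hypothesis submod : forall x y, (x < r)%N -> (y < t)%N ->
  F x.+1 y.+1 + F x y <= F x.+1 y + F x y.+1.

Lemma marginal_at_axis x y : (x <= r)%N -> (y < t)%N ->
  F x y.+1 - F x y <= F 0 y.+1 - F 0 y.
Proof.
move=> + yt; elim: x => // x IH xr; have := IH (ltnW xr); have := submod xr yt; lra.
Qed.

Lemma axis_concave x y : (x <= r)%N -> (y < t)%N ->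
  y%:R * (F x y.+1 - F x y) <= F x y - F x 0.
Proof.
move=> xr; elim: y => [|y IH] yt; first by rewrite mul0r subrr.
have := IH (ltnW yt); have := concave_r xr yt; rewrite -natr1.
have : 0 <= y%:R :> R by []; nra.
Qed.

(** By concavity and F(0, 0) >= 0, the ratio F(0, y) / y does not increase with y. *)
Lemma axis_average y : 0 <= F 0 0 -> (y <= t)%N -> y%:R * F 0 t <= t%:R * F 0 y.
Proof.
move=> F0 yt; rewrite -(subnKC yt).
have [->|y0] := posnP y; first by rewrite mul0r mulr_ge0.
have {yt} : (y + (t - y) <= t)%N by lia.
move: (t - y)%N => d; elim: d => [|d IH] dt; first by rewrite addn0.
rewrite addnS in dt *; have {IH} := IH (ltnW dt).
have := axis_concave (leq0n r) dt; rewrite -natr1.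
have : 0 < (y + d)%:R :> R by rewrite ltr0n addn_gt0 y0.
have : 0 <= y%:R :> R by [].
move: (y + d)%N (y%:R : R) => e c c0 e0 h1 h2.
rewrite -(ler_pM2l e0).
have : c * (e%:R * F 0 e.+1) <= c * ((e%:R + 1) * F 0 e).
  by apply: ler_wpM2l => //; lra.
have : (e%:R + 1) * (c * F 0 e) <= (e%:R + 1) * (e%:R * F 0 y).
  by apply: ler_wpM2l => //; lra.
by lra.
Qed.

(** The path keeps y = ceil(k t / n), so it moves in the second coordinate exactly when this ceiling
    rises at k + 1. *)
Definition diag_step k x y : R :=
  if (y * n < k.+1 * t)%N then F x y.+1 - F x y else F x.+1 y - F x y.

Hypothesis exchange : forall k x y, (k.+1 < n)%N -> (x + y)%N = k ->
  (k * t <= y * n)%N -> (y * n < k * t + n)%N -> (x < r)%N -> (y < t)%N ->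
  F x.+1 y = F x y.+1.

Lemma diag_step_bounds k x y : (k < n)%N -> (x + y)%N = k ->
  (k * t <= y * n)%N -> (y * n < k * t + n)%N ->
  if (y * n < k.+1 * t)%N then (x <= r)%N && (y < t)%N else (x < r)%N && (y <= t)%N.
Proof.
move=> kn xyk lo hi; have n0 : (0 < n)%N by lia.
have ktn : (k.+1 * t <= t * n)%N by rewrite mulnC leq_mul2l kn orbT.
have xn : (x * n + y * n = k * r + k * t)%N by rewrite -mulnDl xyk -mulnDr.
have krn : (k * r <= r * n)%N by rewrite mulnC leq_mul2l (ltnW kn) orbT.
case: ifP => [lt|/negbT]; last rewrite -leqNgt => ge; apply/andP; split.
- by rewrite -(leq_pmul2r n0); lia.
- by rewrite -(ltn_pmul2r n0); lia.
(* If r = 0 then n = t, and [ge] would force y > k. *)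
- have [r0|r0] := posnP r; last first.
    have lt : (k * r < r * n)%N by rewrite mulnC ltn_mul2l r0.
    by rewrite -(ltn_pmul2r n0); lia.
  by move: ge xyk; rewrite /n r0 add0n leq_mul2r; lia.
- by rewrite -ltnS -(ltn_pmul2r n0) mulSn; lia.
Qed.

(* The surplus y n - k t of the second coordinate of the diagonal path is Abel
   summed against the marginals, which decrease because by [exchange] they do
   not depend on the direction. *)
Lemma diag_path_advance k x y : (k < n)%N -> (x + y)%N = k ->
  (k * t <= y * n)%N -> (y * n < k * t + n)%N ->
  (y%:R * n%:R - k%:R * t%:R) * diag_step k x y <=
     n%:R * (F 0 y - F 0 0) - t%:R * (F x y - F 0 0) ->
  exists x' y',
  [/\ (x' + y')%N = k.+1, (k.+1 * t <= y' * n)%N, (y' * n < k.+1 * t + n)%N,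
   (y'%:R * n%:R - k.+1%:R * t%:R) * diag_step k x y <=
     n%:R * (F 0 y' - F 0 0) - t%:R * (F x' y' - F 0 0) &
   (k.+1 < n)%N -> diag_step k.+1 x' y' <= diag_step k x y].
Proof.
move=> kn xyk lo hi le; have := diag_step_bounds kn xyk lo hi.
have n0 : 0 <= n%:R :> R by [].
case: ifP => [lt|ge] /andP[xr yt].
  have dE : diag_step k x y = F x y.+1 - F x y by rewrite /diag_step lt.
  rewrite dE in le *.
  exists x, y.+1; split; try by rewrite ?mulSn; lia.
    (* The surplus changes by n - t, and the right side gains at least n - t times the increment,
       which is at most the one on the axis. *)
    have := marginal_at_axis xr yt; rewrite -!natr1; move: le n0.
    move: (n%:R : R) => N le n0 /(ler_wpM2l n0); lra.
  move=> kn1; have lo' : (k.+1 * t <= y.+1 * n)%N by rewrite !mulSn; lia.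
  have hi' : (y.+1 * n < k.+1 * t + n)%N by rewrite (mulSn y); lia.
  have := @diag_step_bounds k.+1 x y.+1 kn1 _ lo' hi'.
  rewrite /diag_step addnS xyk => /(_ erefl); case: ifP => _ /andP[xr' yt'].
    by have := concave_r xr yt'; lra.
  (* At a turn, submodularity bounds the new increment by the one in the same direction at the old
     point, which [exchange] equates with the old step. *)
  have := submod xr' yt; have := exchange kn1 xyk lo hi xr' yt; lra.
have dE : diag_step k x y = F x.+1 y - F x y by rewrite /diag_step ge.
rewrite dE in le *; move/negbT: ge; rewrite -leqNgt => ge.
exists x.+1, y; split; try by rewrite ?mulSn in ge *; lia.
  by rewrite -!natr1; move: le; move: (n%:R : R) => N le; lra.
move=> kn1; have hi' : (y * n < k.+1 * t + n)%N by rewrite mulSn; lia.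
have := @diag_step_bounds k.+1 x.+1 y kn1 _ ge hi'.
rewrite /diag_step addSn xyk => /(_ erefl); case: ifP => _ /andP[xr' yt'].
  have := submod xr yt'; have := exchange kn1 xyk lo hi xr yt'; lra.
by have := concave_l xr' yt; lra.
Qed.

Lemma diag_path k : (k < n)%N -> exists x y,
  [/\ (x + y)%N = k, (k * t <= y * n)%N, (y * n < k * t + n)%N &
   (y%:R * n%:R - k%:R * t%:R) * diag_step k x y <=
     n%:R * (F 0 y - F 0 0) - t%:R * (F x y - F 0 0)].
Proof.
elim: k => [|k IH] kn;
  first by exists 0%N, 0%N; rewrite !mul0r !subrr !mulr0 subrr mul0r.
have [x [y [xyk lo hi le]]] := IH (ltnW kn).
have [x' [y' [xyk' lo' hi' le' dec]]] := diag_path_advance (ltnW kn) xyk lo hi le.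
(* The surplus is nonnegative, so a smaller increment may replace the current one. *)
exists x', y'; split=> //; apply: le_trans _ le'; apply: ler_wpM2l (dec kn).
by rewrite subr_ge0 -!natrM ler_nat.
Qed.

(** At (r, t) the surplus is zero, so the path inequality reads t (F(r, t) - F(0, 0)) <= n (F(0, t)
    - F(0, 0)), and t <= n absorbs F(0, 0). *)
Lemma axis_end : 0 <= F 0 0 -> t%:R * F r t <= n%:R * F 0 t.
Proof.
move=> F0; have [n0|n0] := posnP n.
  have -> : t = 0%N by lia.
  by rewrite n0 !mul0r.
have kn : (n.-1 < n)%N by lia.
have [x [y [xyk lo hi le]]] := diag_path kn.
have [x' [y' []]] := diag_path_advance kn xyk lo hi le.
rewrite prednK // => xyn lo' hi' le' _.
have yt : y' = t.
  apply/eqP; rewrite eqn_leq; apply/andP; split.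
    by rewrite -ltnS -(ltn_pmul2r n0) mulSn addnC [(t * n)%N]mulnC.
  by rewrite -(leq_pmul2r n0) mulnC.
have xr : x' = r by move: xyn; rewrite /n yt; lia.
move: le'; rewrite xr yt mulrC [n%:R * t%:R]mulrC subrr mulr0 subr_ge0 => h.
have : t%:R <= n%:R :> R by rewrite ler_nat leq_addl.
move: h; move: (n%:R : R) => N h tN.
have : 0 <= (N - t%:R) * F 0 0 by rewrite mulr_ge0 // subr_ge0.
lra.
Qed.

Lemma axis_lower_bound y : 0 <= F 0 0 -> (y <= t)%N ->
  y%:R * F r t <= n%:R * F 0 y.
Proof.
move=> F0 yt; have [t0|t0] := posnP t.
  have -> : y = 0%N by lia.
  by rewrite mul0r mulr_ge0.
have tR : 0 < t%:R :> R by rewrite ltr0n.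
rewrite -(ler_pM2l tR) mulrCA.
apply: le_trans (ler_wpM2l _ (axis_end F0)) _ => //.
by rewrite mulrCA [leRHS]mulrCA ler_wpM2l // axis_average.
Qed.

End GridFunctions.

(** * Two-partition functions as grid functions *)

Section TwoPartitionFunctions.
Variables (R : realType) (V : finType) (f : {set V} -> R).
Implicit Types (P S T A : {set V}).

(** Initial segments of fixed enumerations put the set for (0, y) inside the set for (x, y), so that
    monotonicity compares them. *)
Definition set_of_profile P x y : {set V} :=
  [set z in take x (enum P)] :|: [set z in take y (enum (~: P))].

Lemma card_set_of_profile P x y : (x <= #|P|)%N -> (y <= #|~: P|)%N ->
  #|set_of_profile P x y :&: P| = x /\ #|set_of_profile P x y :&: ~: P| = y.
Proof.
move=> xP yP; rewrite /set_of_profile.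
have Bx := card_take_enum xP; have Cy := card_take_enum yP.
move: Bx Cy; set B := [set z in take _ (enum P)]; set C := [set z in take _ _].
move=> Bx Cy; have BP : B \subset P := take_enum_sub _ _.
have CP : C \subset ~: P := take_enum_sub _ _.
have e1 : C :&: P = set0 by apply/eqP; rewrite setI_eq0 disjoints_subset.
have e2 : B :&: ~: P = set0.
  by apply/eqP; rewrite setI_eq0 disjoints_subset setCK.
by rewrite !setIUl e1 e2 (setIidPl BP) (setIidPl CP) setU0 set0U.
Qed.

Lemma f_profile P S : depends_on f P ->
  f S = f (set_of_profile P #|S :&: P| #|S :&: ~: P|).
Proof.
move=> fP; have [|//|e1 e2] := @card_set_of_profile P #|S :&: P| #|S :&: ~: P|.
- by rewrite subset_leq_card ?subsetIr.
- by rewrite subset_leq_card ?subsetIr.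
by apply: fP; rewrite ?e1 ?e2.
Qed.

Lemma submodular_exchange A u v : submodular f ->
  u \notin A -> v \notin A -> u != v ->
  f (u |: (v |: A)) + f A <= f (u |: A) + f (v |: A).
Proof.
move=> fS uA vA uv; have := fS (u |: A) (v |: A).
rewrite setUACA setUid -setUA.
suff -> : (u |: A) :&: (v |: A) = A by [].
apply/setP=> z; rewrite !inE; case: (eqVneq z u) => [->|_] /=.
  by rewrite (negbTE uA) orbF; apply: negbTE.
by case: (eqVneq z v) => [->|_] /=; rewrite ?(negbTE vA) ?andbb.
Qed.

(** Membership in P enters as a number, so one statement yields both concavity inequalities and the
    mixed one, according to the parts of u and v. *)
Lemma profile_exchange P x y u v (A := set_of_profile P x y) :
  depends_on f P -> submodular f -> (x <= #|P|)%N -> (y <= #|~: P|)%N ->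
  u \notin A -> v \notin A -> u != v ->
  f (set_of_profile P ((u \in P) + (v \in P) + x) ((u \notin P) + (v \notin P) + y))
    + f A <= f (set_of_profile P ((u \in P) + x) ((u \notin P) + y))
           + f (set_of_profile P ((v \in P) + x) ((v \notin P) + y)).
Proof.
move=> fP fS xP yP uA vA uv; have := submodular_exchange fS uA vA uv.
have [e1 e2] := card_set_of_profile xP yP.
have uvA : u \notin v |: A by rewrite in_setU1 negb_or uv.
rewrite (f_profile (u |: (v |: A)) fP) (f_profile (u |: A) fP).
rewrite (f_profile (v |: A) fP) !cardU1I // e1 e2 !addnA.
by rewrite !in_setC.
Qed.

Lemma card_outside_profile P x y k : (x <= #|P|)%N -> (y <= #|~: P|)%N ->
  (x + k <= #|P|)%N -> (k <= #|P :\: set_of_profile P x y|)%N.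
Proof.
move=> xP yP xk; have [e1 _] := card_set_of_profile xP yP.
by rewrite cardsD setIC e1; lia.
Qed.

Lemma card_outside_profileC P x y k : (x <= #|P|)%N -> (y <= #|~: P|)%N ->
  (y + k <= #|~: P|)%N -> (k <= #|~: P :\: set_of_profile P x y|)%N.
Proof.
move=> xP yP xk; have [_ e1] := card_set_of_profile xP yP.
by rewrite cardsD setIC e1; lia.
Qed.

(** The windows are built from k although the sets compared have size k + 1: they must contain both
    one-element extensions of a path point. *)
Definition near_typical P k S :=
  near_mean #|V| k #|P| #|S :&: P| && near_mean #|V| k #|~: P| #|S :&: ~: P|.

(** Together with equal singletons this makes the default output correct; its failure provides the
    two profiles that sampling must hit. *)
Definition typical_symmetric P := forall k S T, (k.+1 < #|V|)%N ->
  #|S| = k.+1 -> #|T| = k.+1 -> near_typical P k S -> near_typical P k T ->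
  f S = f T.

Lemma card_split P S : #|S| = (#|S :&: P| + #|S :&: ~: P|)%N.
Proof. by rewrite -setDE cardsID. Qed.

Lemma part_lower_bound P S : nonnegative f -> monotone f -> submodular f ->
  depends_on f P -> typical_symmetric P ->
  #|S :&: ~: P|%:R * f setT <= #|V|%:R * f S.
Proof.
move=> f0 fm fS fP sym.
pose F x y := f (set_of_profile P x y).
have nE : #|V| = (#|P| + #|~: P|)%N by rewrite cardsC.
have tE : f setT = F #|P| #|~: P| by rewrite (f_profile setT fP) !setTI.
(* Monotonicity discards the elements of S in P, which leaves a bound on the axis x = 0. *)
apply: (@le_trans _ _ (#|V|%:R * F 0 #|S :&: ~: P|)); last first.
  rewrite ler_wpM2l // (f_profile S fP); apply: fm.
  by rewrite /set_of_profile take0 setUSS //; apply/subsetP=> z; rewrite inE.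
have le : (#|S :&: ~: P| <= #|~: P|)%N by rewrite subset_leq_card ?subsetIr.
rewrite tE nE; apply: axis_lower_bound => //; last exact: f0.
- move=> x y xr yt; have xP : (x <= #|P|)%N by lia.
  have /card_gt1P[u [v []]] := @card_outside_profile P x y 2 xP yt ltac:(lia).
  rewrite !in_setD ?in_setC => /andP[uA uP] /andP[vA vP] uv.
  by have := profile_exchange fP fS xP yt uA vA uv; rewrite uP vP.
- move=> x y xr yt; have yP : (y <= #|~: P|)%N by lia.
  have /card_gt1P[u [v []]] := @card_outside_profileC P x y 2 xr yP ltac:(lia).
  rewrite !in_setD ?in_setC => /andP[uA uP] /andP[vA vP] uv.
  have := profile_exchange fP fS xr yP uA vA uv.
  by rewrite uP vP (negbTE uP) (negbTE vP).
- move=> x y xr yt; have xP := ltnW xr; have yP := ltnW yt.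
  have /card_gt0P[u] := @card_outside_profile P x y 1 xP yP ltac:(lia).
  have /card_gt0P[v] := @card_outside_profileC P x y 1 xP yP ltac:(lia).
  rewrite !in_setD ?in_setC => /andP[vA vP] /andP[uA uP].
  have uv : u != v by apply: contraNneq vP => <-.
  by have := profile_exchange fP fS xP yP uA vA uv; rewrite uP vP (negbTE vP).
(* Both extensions of the path point have size k + 1 and lie in the windows, so [sym] equates their
   values. *)
- move=> k x y kn xyk lo hi xr yt.
  have [e1 e2] := card_set_of_profile xr (ltnW yt).
  have [e3 e4] := card_set_of_profile (ltnW xr) yt.
  have xn : (x * (#|P| + #|~: P|) + y * (#|P| + #|~: P|) = k * #|P| + k * #|~: P|)%N.
    by rewrite -mulnDl xyk -mulnDr.
  apply: (sym k); rewrite ?card_split ?e1 ?e2 ?e3 ?e4; try lia.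
  + by rewrite (card_split P) e1 e2; lia.
  + by rewrite (card_split P) e3 e4; lia.
  + by rewrite /near_typical /near_mean e1 e2 nE; rewrite !mulSn; lia.
  + by rewrite /near_typical /near_mean e3 e4 nE; rewrite !mulSn; lia.
Qed.

Lemma typical_symmetricC P : typical_symmetric P -> typical_symmetric (~: P).
Proof.
move=> sym k S T kn Sk Tk; rewrite /near_typical setCK.
rewrite ![near_mean _ _ #|~: P| _ && _]andbC.
exact: sym.
Qed.

Lemma size_lower_bound P S : nonnegative f -> monotone f -> submodular f ->
  depends_on f P -> typical_symmetric P ->
  #|S|%:R * f setT <= 2 * #|V|%:R * f S.
Proof.
move=> f0 fm fS fP sym; have := part_lower_bound S f0 fm fS fP sym.
have := part_lower_bound S f0 fm fS (depends_onC fP) (typical_symmetricC sym).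
by rewrite setCK (card_split P S) natrD; lra.
Qed.

(** Submodularity and f >= 0 give subadditivity, so elements split off one at a time; S is nonempty
    because f may be positive at the empty set. *)
Lemma size_upper_bound a S : nonnegative f -> submodular f ->
  (forall v, f [set v] = a) -> S != set0 -> f S <= #|S|%:R * a.
Proof.
move=> f0 fS fa; have [k] := ubnP #|S|; elim: k S => // k IH S Sk /set0Pn[v vS].
have [S1|S1] := eqVneq (S :\ v) set0.
  by rewrite -(setD1K vS) S1 setU0 cards1 fa mul1r.
have := fS [set v] (S :\ v); rewrite setD1K // fa.
have cE := cardsD1 v S; rewrite vS add1n in cE.
have := IH (S :\ v) ltac:(lia) S1; have := f0 ([set v] :&: (S :\ v)).
by rewrite cE -natr1; lra.
Qed.

Lemma default_output_approximates P (j : V) : nonnegative f -> monotone f ->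
  submodular f -> depends_on f P -> typical_symmetric P ->
  (forall u v, f [set u] = f [set v]) -> approximates f (default_output f j).
Proof.
move=> f0 fm fS fP sym f1.
have n1 : 1 <= Num.sqrt (#|V|%:R : R).
  rewrite -[leLHS]sqrtr1 ler_sqrt // ler1n; apply/card_gt0P; by exists j.
have sq : Num.sqrt (#|V|%:R : R) ^+ 2 = #|V|%:R by rewrite sqr_sqrtr.
apply/forallP=> S; rewrite /default_output.
case: (eqVneq S set0) => [->|S0].
  by rewrite lexx ler_peMl //; lra.
have s0 := f0 S; have sT := fm _ _ (subsetT S).
case: ifP => [le|/negbT]; last first.
  rewrite -ltNge => lt.
  have h := size_lower_bound S f0 fm fS fP sym; rewrite -sq in h.
  move: h lt n1; move: (Num.sqrt _) => w h lt w1.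
  have w0 : 0 < 2 * w by lra.
  apply/andP; split; last by rewrite mulrC divfK // gt_eqF.
  (* Here |S| > 2 w with w the square root of |V|; cancelling 2 w in the size bound leaves f(V) <= w
     f(S). *)
  rewrite ler_pdivrMr //.
  have : 2 * w * f setT <= 2 * w ^+ 2 * f S.
    by apply: le_trans h; apply: ler_wpM2r => //; apply: ltW.
  rewrite expr2 -!mulrA (ler_pM2l (ltr0Sn _ 1)) ler_pM2l; last by lra.
  by nra.
have [v vS] := set0Pn _ S0; apply/andP; split.
  by rewrite (f1 j v); apply: fm; rewrite sub1set.
apply: le_trans (size_upper_bound f0 fS (f1^~ j) S0) _.
by apply: ler_wpM2r.
Qed.

End TwoPartitionFunctions.

(** * Probability of hitting a profile class *)

Section Sampling.
Variables (R : realType) (V : finType).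
Implicit Types (P S T A : {set V}) (q : R).

Lemma incl_pmf_ge0 q S : 0 <= q <= 1 -> 0 <= incl_pmf q S.
Proof.
by case/andP=> q0 q1; apply: prodr_ge0 => v _; case: ifP; rewrite ?subr_ge0.
Qed.

Lemma sum_incl_pmf q : \sum_(S : {set V}) incl_pmf q S = 1.
Proof.
transitivity (\prod_(v : V) (q + (1 - q))).
  by rewrite bigA_distr; apply: eq_bigl => S; rewrite inE.
by rewrite big1 // => v _; rewrite addrC subrK.
Qed.

Lemma incl_pmfE q S : incl_pmf q S = q ^+ #|S| * (1 - q) ^+ (#|V| - #|S|).
Proof.
rewrite /incl_pmf (bigID (mem S)) /=; congr (_ * _).
  by rewrite (eq_bigr (fun=> q)) => [|v ->//]; rewrite prodr_const.
rewrite (eq_bigr (fun=> 1 - q)) => [|v /negbTE->//]; rewrite prodr_const.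
by rewrite -(cardC S) addKn.
Qed.

Definition profile_class P x y :=
  [set S : {set V} | (#|S :&: P| == x) && (#|S :&: ~: P| == y)].

(** A subset of P and a subset of its complement are recovered from their union, so taking unions is
    injective. *)
Lemma card_profile_class P x y :
  ('C(#|P|, x) * 'C(#|~: P|, y) <= #|profile_class P x y|)%N.
Proof.
rewrite -!cards_draws -cardsX; set X := setX _ _.
have XP (AB : {set V} * {set V}) : AB \in X ->
    [/\ (AB.1 :|: AB.2) :&: P = AB.1, (AB.1 :|: AB.2) :&: ~: P = AB.2,
       #|AB.1| = x & #|AB.2| = y].
  rewrite !inE => /andP[/andP[AP /eqP ->] /andP[BP /eqP->]].
  have e1 : AB.2 :&: P = set0 by apply/eqP; rewrite setI_eq0 disjoints_subset.
  have e2 : AB.1 :&: ~: P = set0.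
    by apply/eqP; rewrite setI_eq0 disjoints_subset setCK.
  by rewrite !setIUl e1 e2 (setIidPl AP) (setIidPl BP) setU0 set0U.
have inj : {in X &, injective (fun AB => AB.1 :|: AB.2)}.
  move=> [A B] [A' B'] /XP[/= e1 e2 _ _] /XP[/= e3 e4 _ _] e.
  by congr pair; [rewrite -e1 e e3 | rewrite -e2 e e4].
rewrite -(card_in_imset inj); apply: subset_leq_card.
apply/subsetP=> _ /imsetP[AB /XP[e1 e2 e3 e4] ->].
by rewrite inE e1 e2 e3 e4 !eqxx.
Qed.

(** The class has at least the product of two binomial probabilities, each at least 1 / ((r + 1)
    n^4) for a part of size r. As (|P| + 1)(|V \ P| + 1) <= n^2, the exponent is 2 + 4 + 4. *)
Lemma profile_class_prob P k S : (k.+1 < #|V|)%N -> near_typical P k S ->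
  (#|V|%:R ^+ 10)^-1 <=
  \sum_(T in profile_class P #|S :&: P| #|S :&: ~: P|)
     incl_pmf (k.+1%:R / #|V|%:R : R) T.
Proof.
move=> kn /andP[nx ny]; set n := #|V|; set x := #|_ :&: P|; set y := #|_ :&: ~: _|.
have nE : n = (#|P| + #|~: P|)%N by rewrite cardsC.
have xP : (x <= #|P|)%N by rewrite subset_leq_card ?subsetIr.
have yP : (y <= #|~: P|)%N by rewrite subset_leq_card ?subsetIr.
have n0 : n%:R != 0 :> R by rewrite pnatr_eq0; lia.
set N := #|profile_class P x y|.
pose w := (N * (k.+1 ^ (x + y) * (n - k.+1) ^ (n - (x + y))))%N.
have -> : \sum_(T in profile_class P x y) incl_pmf (k.+1%:R / n%:R : R) T
          = w%:R / n%:R ^+ n.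
  rewrite (eq_bigr (fun=>
    (k.+1 ^ (x + y) * (n - k.+1) ^ (n - (x + y)))%:R / n%:R ^+ n)).
    by rewrite sumr_const -[LHS]mulr_natl mulrA -natrM.
  move=> T; rewrite inE => /andP[/eqP Tx /eqP Ty].
  rewrite incl_pmfE (card_split P) Tx Ty -/n.
  have -> : 1 - k.+1%:R / n%:R = (n - k.+1)%:R / n%:R :> R.
    by rewrite natrB ?(ltnW kn) // mulrBl divff.
  have xyn : (x + y <= n)%N by lia.
  by rewrite !expr_div_n mulrACA -invfM -exprD subnKC // natrM !natrX.
have wE : (n ^ n <= n ^ 10 * w)%N.
  have h1 := bin_weight_near_mean kn (max_card _) xP nx.
  have h2 := bin_weight_near_mean kn (max_card _) yP ny.
  have h3 : (#|P|.+1 * #|~: P|.+1 <= n ^ 2)%N.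
    by rewrite nE; have : (2 <= #|P| + #|~: P|)%N by [lia]; nia.
  have h4 : (bin_weight k.+1 (n - k.+1) #|P| x *
             bin_weight k.+1 (n - k.+1) #|~: P| y <= w)%N.
    rewrite /bin_weight mulnACA leq_mul ?card_profile_class //.
    rewrite mulnACA -!expnD mulnC.
    by have -> : (#|P| - x + (#|~: P| - y) = n - (x + y))%N by lia.
  have -> : (n ^ n = n ^ #|P| * n ^ #|~: P|)%N by rewrite -expnD -nE.
  apply: leq_trans (leq_mul h1 h2) _.
  have -> : (n ^ 10 = n ^ 2 * (n ^ 4 * n ^ 4))%N by rewrite -!expnD.
  by rewrite mulnACA leq_mul // mulnACA leq_mul.
have np : 0 < n%:R ^+ 10 :> R by rewrite exprn_gt0 // lt0r n0 ler0n.
have nq : 0 < n%:R ^+ n :> R by rewrite exprn_gt0 // lt0r n0 ler0n.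
rewrite -[leLHS]mul1r ler_pdivrMr // mulrAC ler_pdivlMr // mul1r mulrC.
by rewrite -!natrX -natrM ler_nat.
Qed.

Section Samples.
Variable m : nat.
Implicit Types X : samples V m.

Lemma rate_itv (i : 'I_(#|V| - 2)) : 0 <= (i.+2%:R / #|V|%:R : R) <= 1.
Proof.
have lt := ltn_ord i; have n0 : 0 < #|V|%:R :> R by rewrite ltr0n; lia.
rewrite divr_ge0 //= ler_pdivrMr // mul1r ler_nat.
by move: lt; rewrite ltn_subRL add2n => /ltnW.
Qed.

Lemma samples_pmf_ge0 X : 0 <= samples_pmf R X.
Proof. by apply: prodr_ge0 => ik _; rewrite incl_pmf_ge0 ?rate_itv. Qed.

Lemma sum_samples_pmf : \sum_(X : samples V m) samples_pmf R X = 1.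
Proof.
rewrite /samples_pmf -(bigA_distr_bigA
  (fun (ik : 'I_(#|V| - 2) * 'I_m) S => incl_pmf (ik.1.+2%:R / #|V|%:R) S)).
by rewrite big1 // => ik _; rewrite sum_incl_pmf.
Qed.

(** The event constrains only the independent samples of index i; those of every other index
    contribute total mass 1. *)
Lemma miss_prob (i : 'I_(#|V| - 2)) (A : {set {set V}}) :
  \sum_(X : samples V m | [forall k, X (i, k) \notin A]) samples_pmf R X
  = (1 - \sum_(S in A) incl_pmf (i.+2%:R / #|V|%:R : R) S) ^+ m.
Proof.
pose Q (ik : 'I_(#|V| - 2) * 'I_m) S := (ik.1 == i) ==> (S \notin A).
transitivity (\sum_(X in family Q) samples_pmf R X).
  apply: eq_bigl => X; apply/forallP/familyP => /= h.
    by move=> [i' k]; apply/implyP => /= /eqP ->; apply: h.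
  by move=> k; have /implyP := h (i, k); apply; rewrite eqxx.
rewrite /samples_pmf -(bigA_distr_big_dep Q
  (fun (ik : 'I_(#|V| - 2) * 'I_m) S => incl_pmf (ik.1.+2%:R / #|V|%:R) S)).
rewrite -(pair_bigA _ (fun i' k =>
   \sum_(S | Q (i', k) S) incl_pmf (i'.+2%:R / #|V|%:R : R) S)) /=.
rewrite (bigD1 i) //= [X in _ * X]big1 => [|i' ne]; last first.
  rewrite [LHS]big1 // => k _; rewrite -[RHS](sum_incl_pmf (i'.+2%:R / #|V|%:R)).
  by apply: eq_bigl => S; rewrite /Q /= (negbTE ne).
rewrite mulr1 -[m in RHS]card_ord -prodr_const; apply: eq_bigr => k _.
rewrite -[X in X - _](sum_incl_pmf (i.+2%:R / #|V|%:R)).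
rewrite [in RHS](bigID (mem A)) /= [X in X - _]addrC addrK.
by apply: eq_bigl => S; rewrite /Q /= eqxx.
Qed.

(** A union bound over the two misses, each of probability at most (1 - e)^m <= exp(- e m). *)
Lemma hit_two_prob (i : 'I_(#|V| - 2)) (A B : {set {set V}}) (e : R)
    (E : pred (samples V m)) :
  0 <= e ->
  e <= \sum_(S in A) incl_pmf (i.+2%:R / #|V|%:R : R) S ->
  e <= \sum_(S in B) incl_pmf (i.+2%:R / #|V|%:R : R) S ->
  (forall X k l, X (i, k) \in A -> X (i, l) \in B -> E X) ->
  1 - 2 * expR (- e *+ m) <= samples_prob R E.
Proof.
move=> e0 eA eB hE.
have miss (C : {set {set V}}) :
    e <= \sum_(S in C) incl_pmf (i.+2%:R / #|V|%:R : R) S ->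
    \sum_(X : samples V m | [forall k, X (i, k) \notin C]) samples_pmf R X
      <= expR (- e *+ m).
  move=> eC; rewrite miss_prob -[- e *+ m]mulr_natl expRM_natl.
  rewrite lerXn2r ?nnegrE ?expR_ge0 //.
    rewrite subr_ge0 -[leRHS](sum_incl_pmf (i.+2%:R / #|V|%:R)).
    rewrite [leRHS](bigID (mem C)) /= lerDl sumr_ge0 // => S _.
    by rewrite incl_pmf_ge0 ?rate_itv.
  by apply: le_trans (expR_ge1Dx _); rewrite lerD2l lerN2.
have := miss A eA; have := miss B eB.
suff : 1 <= samples_prob R E
   + \sum_(X : samples V m | [forall k, X (i, k) \notin A]) samples_pmf R X
   + \sum_(X : samples V m | [forall k, X (i, k) \notin B]) samples_pmf R X by lra.
rewrite -[leLHS]sum_samples_pmf /samples_prob.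
rewrite (big_mkcond E) (big_mkcond (fun X => [forall k, X (i, k) \notin A])).
rewrite (big_mkcond (fun X => [forall k, X (i, k) \notin B])) -!big_split /=.
apply: ler_sum => X _; have p0 := samples_pmf_ge0 X.
case: (boolP [forall k, X (i, k) \notin A]) => [_|]; first by do 2 case: ifP => _; lra.
case/forallPn=> k; rewrite negbK => kA.
case: (boolP [forall k, X (i, k) \notin B]) => [_|]; first by case: ifP => _; lra.
case/forallPn=> l; rewrite negbK => lB.
by rewrite (hE X k l kA lB) !addr0.
Qed.

End Samples.
End Sampling.

Lemma num_samples_bound (R : realType) (n : nat) (p : R) : (0 < n)%N ->
  0 < p -> p < 1 ->
  2 * expR (- (n%:R ^+ 10)^-1 *+ num_samples n p) <= 1 - p.
Proof.
move=> n0 p0 p1; have nR : 1 <= n%:R :> R by rewrite ler1n.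
have q0 : 0 < 1 - p by lra.
set c := 4 * n%:R / (1 - p).
have c0 : 0 < c by rewrite divr_gt0 //; lra.
have c1 : 1 <= c by rewrite ler_pdivlMr //; lra.
have N0 : 0 < n%:R ^+ 10 :> R by rewrite exprn_gt0 //; lra.
have le : n%:R ^+ 10 * ln c <= (num_samples n p)%:R.
  (* As c >= 1, the rounded quantity is nonnegative and the absolute value of its ceiling is the
     ceiling itself. *)
  have h0 : 0 <= n%:R ^+ 10 * ln c by rewrite mulr_ge0 ?ln_ge0 // ltW.
  apply: le_trans (ceil_ge _) _.
  rewrite /num_samples -/c natr_absz ger0_norm // ceil_ge0.
  by apply: lt_le_trans h0; rewrite ltrN10.
have : expR (- (n%:R ^+ 10)^-1 *+ num_samples n p) <= expR (- ln c).
  by rewrite ler_expR -[leLHS]mulr_natr mulNr lerN2 ler_pdivlMl.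
rewrite expRN lnK ?posrE // => h.
have : c^-1 <= (1 - p) / 4.
  rewrite /c invf_div ler_wpM2l ?lef_pV2 ?posrE //; lra.
lra.
Qed.

(** * Correctness of the procedure *)

Section Procedure.
Variables (R : realType) (D : determiner R) (V : finType) (f : {set V} -> R).
Variables (j : V) (m : nat) (X : samples V m).
Hypothesis D_exact : exact_poly_determiner D.
Hypotheses (f_ge0 : nonnegative f) (f_mono : monotone f) (f_2P : two_partition f).

Lemma approximates_exact (g : {set V} -> R) : g =1 f -> approximates f g.
Proof.
move=> gf; apply/forallP=> S; rewrite gf lexx /= ler_peMl //.
have : 1 <= Num.sqrt (#|V|%:R : R).
  by rewrite -[leLHS]sqrtr1 ler_sqrt // ler1n; apply/card_gt0P; exists j.
by lra.
Qed.

Lemma procedure_approximates_default :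
  approximates f (default_output f j) -> approximates f (procedure_output D f j X).
Proof.
rewrite /procedure_output; case: pickP => [[S T] /and4P[_ _ /eqP ST /eqP fST] _|//].
case: D_exact => c [d Dcd]; apply: approximates_exact.
by have [] := Dcd V f S T f_ge0 f_mono f_2P ST fST.
Qed.

(** The pair picked may differ from (S, T), but any pair of equal size and different values lets D
    recover f. *)
Lemma procedure_approximates_found S T :
  S \in queried X -> T \in queried X -> #|S| = #|T| -> f S <> f T ->
  approximates f (procedure_output D f j X).
Proof.
move=> qS qT ST fST; rewrite /procedure_output.
case: pickP => [[S' T'] /and4P[_ _ /eqP ST' /eqP fST']|/(_ (S, T))]; last first.
  by rewrite /= qS qT ST eqxx /=; move/eqP: fST => ->.
case: D_exact => c [d Dcd]; apply: approximates_exact.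
by have [] := Dcd V f S' T' f_ge0 f_mono f_2P ST' fST'.
Qed.

End Procedure.

Lemma samples_prob_true (R : realType) (V : finType) (m : nat)
    (E : pred (samples V m)) : (forall X, E X) -> samples_prob R E = 1.
Proof.
by move=> ET; rewrite -[RHS](sum_samples_pmf R V m); apply: eq_bigl => X; rewrite ET.
Qed.

Theorem theorem22 (R : realType) (D : determiner R)
    (D_exact : exact_poly_determiner D)
    (V : finType) (f : {set V} -> R)
    (f_ge0 : nonnegative f) (f_mono : monotone f) (f_2P : two_partition f)
    (p : R) (p_gt0 : 0 < p) (p_lt1 : p < 1) (j : V) :
  p <= samples_prob R
         (fun X : samples V (num_samples #|V| p) =>
            approximates f (procedure_output D f j X)).
Proof.
have [f_sub [P fP]] := f_2P.
have [f1|/existsNP[u /existsNP[v fuv]]] :=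
    pselect (forall u v, f [set u] = f [set v]); last first.
  (* All singletons are queried whatever the samples, so success is certain. *)
  rewrite samples_prob_true ?ltW // => X.
  apply: (@procedure_approximates_found _ _ _ _ _ _ X _ _ _ _ [set u] [set v]) => //.
  - by rewrite inE; apply/or4P/Or43/existsP; exists u.
  - by rewrite inE; apply/or4P/Or43/existsP; exists v.
  - by rewrite !cards1.
have [sym|nsym] := pselect (typical_symmetric f P).
  rewrite samples_prob_true ?ltW // => X.
  apply: procedure_approximates_default => //.
  exact: (default_output_approximates (P := P)).
move: nsym; rewrite /typical_symmetric.
move=> /existsNP[k /existsNP[S /existsNP[T]]].
move=> /not_implyP[kn /not_implyP[Sk /not_implyP[Tk]]].
move=> /not_implyP[nS /not_implyP[nT fST]].
(* Size 1 is not sampled; there the equality of singletons contradicts [fST]. *)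
case: k kn Sk Tk nS nT => [|k] kn Sk Tk nS nT.
  move/eqP/cards1P: Sk fST => [u ->]; move/eqP/cards1P: Tk => [v ->].
  by move/(_ (f1 u v)).
(* The two sets now have size k + 2, and sample index k has rate (k + 2) / |V|. *)
have ki : (k < #|V| - 2)%N by lia.
pose cl W := profile_class P #|W :&: P| #|W :&: ~: P|.
(* Any members of the two classes serve as the separating pair, since size and value are constant on
   a class. *)
have clP W W' : W' \in cl W -> #|W'| = #|W| /\ f W' = f W.
  rewrite inE => /andP[/eqP e1 /eqP e2]; split; last exact: fP.
  by rewrite (card_split P) e1 e2 -card_split.
have bound : p <= 1 - 2 * expR (- (#|V|%:R ^+ 10)^-1 *+ num_samples #|V| p).
  have n0 : (0 < #|V|)%N by lia.
  by have := num_samples_bound n0 p_gt0 p_lt1; lra.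
apply: le_trans bound _.
apply: (hit_two_prob (i := Ordinal ki) (A := cl S) (B := cl T)).
- by rewrite invr_ge0 exprn_ge0.
- exact: profile_class_prob.
- exact: profile_class_prob.
move=> X a b /clP[eS fS] /clP[eT fT].
apply: (@procedure_approximates_found _ _ _ _ _ _ X _ _ _ _
          (X (Ordinal ki, a)) (X (Ordinal ki, b))) => //.
- by rewrite inE; apply/or4P/Or44/existsP; exists (Ordinal ki, a).
- by rewrite inE; apply/or4P/Or44/existsP; exists (Ordinal ki, b).
- by rewrite eS eT Sk Tk.
- by rewrite fS fT.
Qed.
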